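(* Let $H$ be a real Hilbert space, let $C$ be a nonempty closed convex subset of $H$, and let $B:H\to H$ be a $\beta$-cocoercive operator, $\beta>0$. Let $\Omega$ be the solution set of the variational inequality problem: find $x^*\in C$ such that $\langle Bx^*,y-x^*\rangle\ge0$ for all $y\in C$; assume $\Omega\ne\emptyset$. Let $\alpha>0$, $\{\eta_k\}_{k\in\mathbb N}\in\ell^1_+(\mathbb N)$ and $\{U_k\}_{k\in\mathbb N}\subset\mathcal P_\alpha(H)$ be such that $\mu:=\sup_{k\in\mathbb N}\|U_k\|<+\infty$ and $(1+\eta_k)U_{k+1}\succeq U_k$ for all $k\in\mathbb N$. Let $\gamma_k\in(0,\frac{2\beta}{\|U_k\|})$ and $\lambda_k\in(0,\frac1{\alpha_k})$, where $\alpha_k=\frac{2\beta}{4\beta-\gamma_k\|U_k\|}$, for all $k\in\mathbb N$. Let $\{a_k\},\{b_k\}$ be sequences in $H$ with $\sum_{k=0}^{+\infty}\lambda_k\|a_k\|<+\infty$ and $\sum_{k=0}^{+\infty}\lambda_k\|b_k\|<+\infty$. Assume moreover that at least one of the following two sets of conditions holds, where $\underline\lambda,\tau,\underline\gamma,\epsilon$ are constants and the inequalities hold for all $k$: (A) $0<\underline\lambda\le\lambda_k\le\frac1{\alpha_k}-\tau$ with $\tau\in(0,\frac1{\alpha_k}-\underline\lambda)$; and $0<\underline\gamma\le\gamma_k\le\frac{2\beta-\epsilon}{\mu}$ with $\epsilon\in(0,2\beta-\mu\underline\gamma)$. (B) $\sum_{k=0}^{+\infty}\lambda_k(\frac1{\alpha_k}-\lambda_k)=+\infty$;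 $0<\underline\gamma\le\gamma_k\le\frac{2\beta-\epsilon}{\mu}$ with $\epsilon\in(0,2\beta-\mu\underline\gamma)$; $\sum_{k=0}^{+\infty}|\gamma_{k+1}-\gamma_k|<+\infty$, $\sum_{k=0}^{+\infty}\big|\gamma_{k+1}\|U_{k+1}\|-\gamma_k\|U_k\|\big|<+\infty$, and $\sum_{k=0}^{+\infty}\|U_k^{-1}x-U_{k+1}^{-1}x\|<+\infty$ for any $x\in H$; and $\lambda_k\ge\underline\lambda>0$. Let $x_0\in H$ and, for $k\in\mathbb N$, set $$y_k=x_k-\gamma_kU_k(Bx_k+b_k),\qquad x_{k+1}=x_k+\lambda_k\big(P_C^{U_k^{-1}}(y_k)+a_k-x_k\big).$$ Then the following hold: (i) For any $x^*\in\Omega$, $\lim_{k\to+\infty}\|x_k-x^*\|_{U_k^{-1}}$ exists; (ii) $\lim_{k\to+\infty}\|x_k-P_C^{U_k^{-1}}(x_k-\gamma_kU_kBx_k)\|=0$; (iii) $\{x_k\}$ converges weakly to a point in $\Omega$; (iv) $Bx_k\to Bx^*$ strongly as $k\to+\infty$, where $x^*\in\Omega$.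
   Context: $\mathbb N$ is the set of nonnegative integers, and $\ell^1_+(\mathbb N)$ is the set of summable sequences in $[0,+\infty)$. $B:H\to H$ is $\beta$-cocoercive if $\langle x-y,Bx-By\rangle\ge\beta\|Bx-By\|^2$ for all $x,y\in H$. For bounded self-adjoint linear operators $U,V$ on $H$, $U\succeq V$ means $\langle Ux,x\rangle\ge\langle Vx,x\rangle$ for all $x\in H$; $\mathcal P_\alpha(H)$ is the set of bounded self-adjoint linear operators $U$ on $H$ with $U\succeq\alpha I$. $\|U\|$ is the operator norm. For $U\in\mathcal P_\alpha(H)$ with $\alpha>0$, $\|x\|_{U^{-1}}=\sqrt{\langle U^{-1}x,x\rangle}$, and $P_C^{U^{-1}}(x)=\arg\min_{y\in C}\|x-y\|_{U^{-1}}$ is the projector onto $C$ relative to the norm $\|\cdot\|_{U^{-1}}$. *)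

(* Defs.v *)
From HB Require Import structures.
From mathcomp Require Import all_boot all_order all_algebra.
From mathcomp Require Import all_classical all_reals all_analysis.

Set Implicit Arguments.
Unset Strict Implicit.
Unset Printing Implicit Defensive.

Import Order.TTheory GRing.Theory Num.Theory.
Import numFieldNormedType.Exports.

Local Open Scope classical_set_scope.
Local Open Scope ring_scope.

Section hilbert.
Context {R : realType} {H : completeNormedModType R}.

(* Together with completeness of [H], this makes [(H, dot)] a real Hilbert
   space: the norm of [H] is the one induced by the inner product. *)
Definition norm_from_dot (dot : {dot H for idfun}) : Prop :=
  forall x : H, `|x| ^+ 2 = dot x x.

Variable dot : {dot H for idfun}.

Definition cocoercive (beta : R) (B : H -> H) : Prop :=
  forall x y : H, beta * `|B x - B y| ^+ 2 <= dot (x - y) (B x - B y).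

Definition VI_solutions (C : set H) (B : H -> H) : set H :=
  [set xs | C xs /\ forall y, C y -> 0 <= dot (B xs) (y - xs)].

Definition loewner_ge (U V : H -> H) : Prop :=
  forall x : H, dot (V x) x <= dot (U x) x.

Definition self_adjoint (U : H -> H) : Prop :=
  forall x y : H, dot (U x) y = dot x (U y).

(* For a linear map, being bounded near 0 is being a bounded operator
   (see [linear_boundedP]). *)
Definition Pcal (alpha : R) : set {linear H -> H} :=
  [set U | [/\ bounded_near U (nbhs (0 : H)), self_adjoint U
             & loewner_ge U (alpha \*: (@idfun H))]].

Definition opnorm (U : H -> H) : R :=
  sup [set `|U x| | x in [set x : H | `|x| <= 1]].

(* ['pinv_] is a choice of preimages; it is the two-sided inverse when [U] is
   bijective, in particular when [U] is in [Pcal alpha] with [0 < alpha]. *)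
Definition opinv (U : H -> H) : H -> H := ('pinv_(fun=> 0) [set: H] U)%FORM.

(* [wnorm U] is the norm written with index U^-1. *)
Definition wnorm (U : H -> H) (x : H) : R := Num.sqrt (dot (opinv U x) x).

(* The argmin exists and is unique when [C] is nonempty, closed and convex and
   [U] is in [Pcal alpha] with [0 < alpha]; the default value 0 is then unused. *)
Definition wproj (U : H -> H) (C : set H) (x : H) : H :=
  xget 0 [set p | C p /\ forall y, C y -> wnorm U (x - p) <= wnorm U (x - y)].

Definition weakly_cvg (u : nat -> H) (l : H) : Prop :=
  forall v : H, (fun k => dot (u k) v) @ \oo --> dot l v.

End hilbert.

(* Main.v *)
Require Import Defs.
From HB Require Import structures.
From mathcomp Require Import all_boot all_order all_algebra.
From mathcomp Require Import all_classical all_reals all_analysis.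
From mathcomp Require Import ring lra.

Set Implicit Arguments.
Unset Strict Implicit.
Unset Printing Implicit Defensive.

Import Order.TTheory GRing.Theory Num.Theory.
Import numFieldNormedType.Exports.

Local Open Scope classical_set_scope.
Local Open Scope ring_scope.

(** Write A k for the inverse of [U k], m k for its operator norm, p k for the
    exact forward-backward step from [x k], w k = [x k] - p k for the residual,
    h k = [x k] - x* and d k = B ([x k]) - B x* for a solution x*.

    Either set of conditions supplies constants with lambda k >= lambda_ > 0,
    gamma k >= gamma_ > 0 and gamma k * m k <= 2 beta - eps; the rest of the
    argument starts from these.

    Expanding the variational inequality that characterizes the projection
    gives the averagedness estimate of the forward-backward operator in the
    metric A k with its slack kept ([fb_descent]). Up to nonnegative terms the
    slack is gamma k times the [gap], a positive combination of the defects of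
    three inequalities: cocoercivity, beta |d|^2 <= <h, d>; the square
    |2 beta d - w|^2 >= 0; and |w|^2 <= m <A w, w>. A relaxed step thus
    decreases the squared distance to x* in the metric A k by at least a
    constant times the gap. Passing from the metric A k to A k.+1 costs
    a factor 1 + eta k, because inversion reverses the Loewner order
    ([inv_antimono]), and the errors cost a summable term, because the
    projection is nonexpansive. The distances to x* are therefore quasi-Fejer
    monotone and converge ([quasi_fejer], [dist_cvg]); since the distances
    after the exact step are squeezed to the same limit, the gap tends to 0
    ([gap_cvg0]).

    A vanishing gap forces the residual to vanish, at every relaxation
    parameter up to the largest one ([residual_le]). Indeed, when the gap is
    negligible, m A w is close to w, w is close to 2 beta d, and <h, d> is close
    to beta |d|^2. Hence m <A w, h> is close to |w|^2 / 2, whereas the descent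
    estimate bounds it below by (1 - gamma m / (4 beta)) |w|^2. As gamma m stays
    below 2 beta by eps, this coefficient exceeds 1/2 by a fixed amount,
    so w tends to 0, and d with it.

    For the weak limit, bounded sequences converge weakly along every
    ultrafilter, by the Riesz representation ([weak_ultra_limit]). A weak limit
    along an ultrafilter is a solution, by demiclosedness of B and weak
    closedness of C ([weak_cluster_solution]). Two such limits q and q' agree:
    <x k, A k (q - q')> is a combination of convergent sequences, and
    A k (q - q') converges strongly, because the forms A k decrease up to the
    factors 1 + eta k ([strong_limit]); so <q - q', lim A k (q - q')> = 0, while
    A k >= 1 / mu. *)

(** * Inner products and limits *)

Lemma discr_le {R : realFieldType} (a b c : R) :
  (forall s t, 0 <= s ^+ 2 * a + 2 * (s * t) * b + t ^+ 2 * c) ->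
  b ^+ 2 <= a * c.
Proof.
move=> pos; have c0 : 0 <= c by have := pos 0 1; lra.
have [c_gt0|c_le0] := ltP 0 c.
  have := pos c (- b).
  have -> : c ^+ 2 * a + 2 * (c * - b) * b + (- b) ^+ 2 * c = c * (a * c - b ^+ 2)
    by ring.
  by rewrite pmulr_rge0// subr_ge0.
have c_eq0 : c = 0 by lra.
rewrite {}c_eq0 in pos *.
have [->|b0] := eqVneq b 0; first by rewrite expr0n mulr0.
have := pos 1 (- (a + 1) / (2 * b)).
have -> : 1 ^+ 2 * a + 2 * (1 * (- (a + 1) / (2 * b))) * b +
          (- (a + 1) / (2 * b)) ^+ 2 * 0 = - 1 by field.
by lra.
Qed.

Lemma cvg_sqr {R : realType} {T} {F : set_system T} {FF : Filter F} (u : T -> R)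
    (l : R) : u @ F --> l -> (fun k => u k ^+ 2) @ F --> l ^+ 2.
Proof. by move=> ul; rewrite expr2; under eq_fun do rewrite expr2; exact: cvgM. Qed.

Section InnerProduct.
Context {R : realType} {H : completeNormedModType R} (dot : {dot H for idfun}).
Implicit Types x y z : H.

Lemma dotC x y : dot x y = dot y x.
Proof. by rewrite hermC expr0 mul1r. Qed.
Lemma dotDl x y z : dot (x + y) z = dot x z + dot y z.
Proof. by rewrite linearDl. Qed.
Lemma dotDr x y z : dot x (y + z) = dot x y + dot x z.
Proof. by rewrite linearD. Qed.
Lemma dotNl x z : dot (- x) z = - dot x z.
Proof. by rewrite linearNl. Qed.
Lemma dotNr x z : dot x (- z) = - dot x z.
Proof. by rewrite linearN. Qed.
Lemma dotZl a x z : dot (a *: x) z = a * dot x z.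
Proof. by rewrite linearZl. Qed.
Lemma dotZr a x z : dot x (a *: z) = a * dot x z.
Proof. by rewrite linearZ. Qed.
Lemma dot0l x : dot 0 x = 0.
Proof. by rewrite linear0l. Qed.
Lemma dot0r x : dot x 0 = 0.
Proof. by rewrite linear0. Qed.
Definition dotE := (dotDl, dotDr, dotNl, dotNr, dotZl, dotZr, dot0l, dot0r).

Lemma opD (Q : {linear H -> H}) x y : Q (x + y) = Q x + Q y.
Proof. exact: linearD. Qed.
Lemma opN (Q : {linear H -> H}) x : Q (- x) = - Q x.
Proof. exact: linearN. Qed.
Lemma opZ (Q : {linear H -> H}) a x : Q (a *: x) = a *: Q x.
Proof. exact: linearZ. Qed.
(* Instantiated at an operator: with [Q] left open, the identity would unify. *)
Definition opE Q := (opD Q, opN Q, opZ Q).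

Lemma psd_CS (A : {linear H -> H}) x y : self_adjoint dot A ->
  (forall z, 0 <= dot (A z) z) ->
  dot (A x) y ^+ 2 <= dot (A x) x * dot (A y) y.
Proof.
move=> Asym A0; apply: discr_le => s t.
have := A0 (s *: x + t *: y).
rewrite !(opE A) !dotE (Asym y x) (dotC y).
lra.
Qed.

Hypothesis hdot : norm_from_dot dot.

Lemma dotxx x : dot x x = `|x| ^+ 2. Proof. by rewrite hdot. Qed.

Lemma eq_of_dist_sqr_le0 x y : `|x - y| ^+ 2 <= 0 -> x = y.
Proof.
move=> xy; apply/eqP; rewrite -subr_eq0 -normr_eq0 -sqrf_eq0.
by rewrite eq_le xy sqr_ge0.
Qed.

Lemma dot_CS x y : `|dot x y| <= `|x| * `|y|.
Proof.
rewrite -ler_sqr ?nnegrE ?mulr_ge0// exprMn real_normK ?num_real//.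
rewrite -!dotxx; apply: (@psd_CS idfun) => // z.
by rewrite /= dotxx sqr_ge0.
Qed.

Lemma dot_le x y : dot x y <= `|x| * `|y|.
Proof. exact: le_trans (ler_norm _) (dot_CS _ _). Qed.

Lemma cvg_dot {T} {F : set_system T} {FF : Filter F} (u v : T -> H) a b :
  u @ F --> a -> v @ F --> b -> (fun k => dot (u k) (v k)) @ F --> dot a b.
Proof.
have polar c d : dot c d = 2^-1 * (`|c + d| ^+ 2 - `|c| ^+ 2 - `|d| ^+ 2).
  by rewrite -!dotxx !dotE (dotC d c); field.
move=> ua vb; rewrite polar; under eq_fun do rewrite polar.
by apply: cvgMl_tmp; apply: cvgB; [apply: cvgB|]; apply: cvg_sqr; apply: cvg_norm => //;
  exact: cvgD.
Qed.

End InnerProduct.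

Section Limits.
Context {R : realType} {H : completeNormedModType R}.

Lemma cvg_sqrt0 {T} {F : set_system T} {FF : Filter F} (u : T -> R) :
  u @ F --> (0 : R) -> (fun k => Num.sqrt (u k)) @ F --> (0 : R).
Proof.
move=> u0; rewrite -(@sqrtr0 R).
by apply: continuous_cvg => //; exact: sqrt_continuous.
Qed.

Lemma cvg_sqr0 {T} {F : set_system T} {FF : Filter F} (u : T -> R) :
  (fun k => u k ^+ 2) @ F --> (0 : R) -> (fun k => `|u k|) @ F --> (0 : R).
Proof. by move=> /cvg_sqrt0; under eq_fun do rewrite sqrtr_sqr. Qed.

Lemma squeeze0 {T} {F : set_system T} {FF : Filter F} (u v : T -> R) :
  (forall k, 0 <= u k <= v k) -> v @ F --> (0 : R) -> u @ F --> (0 : R).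
Proof.
move=> uv v0; apply: (@squeeze_cvgr _ _ _ _ (fun=> 0) v) => //.
  by apply: nearW.
exact: cvg_cst.
Qed.

Lemma cvg_dist_sqr0 {T} {F : set_system T} {FF : Filter F} (u : T -> H) l
    (d : T -> R) : (forall k, `|u k - l| ^+ 2 <= d k) -> d @ F --> (0 : R) ->
  u @ F --> l.
Proof.
move=> ud d0; apply/subr_cvg0; apply: norm_cvg0.
have sq0 : (fun k => `|u k - l| ^+ 2) @ F --> (0 : R).
  by apply: squeeze0 d0 => k; rewrite sqr_ge0 ud.
have : (fun k => `| (`|u k - l|) |) @ F --> (0 : R) by exact: cvg_sqr0.
by under eq_fun do rewrite normr_id.
Qed.

Lemma cauchy_dist_sqr (u : nat -> H) (d : nat -> R) :
  (forall m n, (m <= n)%N -> `|u m - u n| ^+ 2 <= d m) ->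
  d @ \oo --> (0 : R) -> cvgn u.
Proof.
move=> ud /cvgrPdist_lt d0; apply/cauchy_cvgP/cauchy_exP => e e0.
have e20 : 0 < e ^+ 2 by rewrite exprn_gt0.
have [N _ Nd] := d0 _ e20; exists (u N), N => //= n Nn.
rewrite -ball_normE/= -ltr_sqr ?nnegrE ?normr_ge0 ?(ltW e0)//.
apply: le_lt_trans (ud _ _ Nn) _.
have := Nd _ (leqnn N); rewrite sub0r normrN; apply: le_lt_trans.
exact: ler_norm.
Qed.

End Limits.

(** * Minimization of quadratic functionals and coercive operators *)

Section LaxMilgram.
Context {R : realType} {H : completeNormedModType R} (dot : {dot H for idfun}).
Hypothesis hdot : norm_from_dot dot.

Lemma convex_comb (C : set H) x y t : convex_set C -> C x -> C y ->
  0 <= t <= 1 -> C (x + t *: (y - x)).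
Proof.
move=> Cconv Cx Cy /andP[t0 t1].
have := Cconv y x (@Itv01 _ t t0 t1).
rewrite !inE => /(_ Cy Cx); rewrite /conv/= /unstable.onem.
by rewrite scalerBl scale1r scalerBr addrCA addrA addrAC -addrA.
Qed.

(** The quadratic functional [J] is bounded below and strongly convex, so the
    parallelogram identity makes every minimizing sequence in [C] Cauchy; the
    inequality is the first-order condition at the minimizer. It gives the
    projection in a metric, the Riesz representation and the surjectivity of a
    coercive operator. *)
Lemma stampacchia (Q : {linear H -> H}) (f : H -> R) (c K M : R) (C : set H) :
  self_adjoint dot Q -> 0 < c -> (forall x, c * `|x| ^+ 2 <= dot (Q x) x) ->
  (forall x, `|Q x| <= K * `|x|) ->
  (forall a x y, f (a *: x + y) = a * f x + f y) ->
  (forall x, `|f x| <= M * `|x|) ->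
  C !=set0 -> closed C -> convex_set C ->
  exists2 p, C p & forall y, C y -> f (y - p) <= dot (Q p) (y - p).
Proof.
move=> Qsym c0 Qc QK flin fM [x0 Cx0] Ccl Cconv.
have fD u v : f (u + v) = f u + f v by rewrite -[u]scale1r flin mul1r scale1r.
have f0 : f 0 = 0 by have := fD 0 0; rewrite addr0; lra.
have fZ a u : f (a *: u) = a * f u by rewrite -[a *: u]addr0 flin f0 addr0.
have fN u : f (- u) = - f u by rewrite -scaleN1r fZ mulN1r.
pose J u := dot (Q u) u - 2 * f u.
have J_line p v t : J (p + t *: v) =
    J p + 2 * t * (dot (Q p) v - f v) + t ^+ 2 * dot (Q v) v.
  rewrite /J !(opE Q) fD fZ !dotE.
  by rewrite (Qsym v p) (dotC _ v); ring.
pose S := [set J u | u in C].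
have S0 : S !=set0 by exists (J x0); exists x0.
have S_lb : has_lbound S.
  exists (- (M ^+ 2 / c)) => _ [u Cu <-].
  have := fM u; have := Qc u; rewrite /J ler_norml => Qu /andP[_ fu].
  have : 0 <= (c * `|u| - M) ^+ 2 / c by rewrite divr_ge0 ?sqr_ge0 ?ltW.
  have -> : (c * `|u| - M) ^+ 2 / c = c * `|u| ^+ 2 - 2 * (M * `|u|) + M ^+ 2 / c.
    by field; exact: lt0r_neq0.
  lra.
pose e := inf S.
have eJ u : C u -> e <= J u by move=> Cu; apply: ge_inf => //; exists u.
have /choice[u u_min] : forall n, exists u, C u /\ J u < e + n.+1%:R^-1.
  move=> n; have n0 : 0 < n.+1%:R^-1 :> R by rewrite invr_gt0.
  by have [_ [u Cu <-] Ju] := inf_adherent n0 (conj S0 S_lb); exists u.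
have Cu n : C (u n) by case: (u_min n).
have uJ n : J (u n) < e + n.+1%:R^-1 by case: (u_min n).
have u_cvg : cvgn u.
  apply: (@cauchy_dist_sqr _ _ _ (fun n => c^-1 * 4 * n.+1%:R^-1)); last first.
    rewrite -[X in _ --> X](mulr0 (c^-1 * 4)); apply: cvgMl_tmp.
    exact: cvg_harmonic.
  move=> m n mn; rewrite -mulrA ler_pdivlMl//.
  apply: le_trans (Qc _) _.
  have Cmid : C (u n + 2^-1 *: (u m - u n)).
    by apply: convex_comb => //; lra.
  have := eJ _ Cmid; rewrite J_line.
  have := J_line (u n) (u m - u n) 1; rewrite scale1r addrCA subrr addr0.
  have : n.+1%:R^-1 <= m.+1%:R^-1 :> R by rewrite lef_pV2 ?posrE// ler_nat.
  have := uJ m; have := uJ n.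
  rewrite expr1n !mul1r mulr1 divff// mul1r (_ : 2^-1 ^+ 2 = 4^-1); last by field.
  move: n.+1%:R^-1 m.+1%:R^-1 => en em un um nm E1 E2; nra.
have u_p : u @ \oo --> limn u by exact: u_cvg.
set p := limn u in u_p.
have Cp : C p by apply: (closed_cvg C Ccl _ p u_p); exact: nearW.
exists p => //.
have upn0 : (fun n => `|u n - p|) @ \oo --> (0 : R).
  by apply/norm_cvg0P/subr_cvg0.
have Qu_cvg : (fun n => Q (u n)) @ \oo --> Q p.
  apply/subr_cvg0; apply: norm_cvg0.
  apply: (@squeeze0 _ _ _ _ _ (fun n => K * `|u n - p|)) => [n|].
    by rewrite normr_ge0 -opN -opD QK.
  by rewrite -(mulr0 K); exact: cvgMl_tmp.
have fu_cvg : (fun n => f (u n)) @ \oo --> f p.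
  apply/subr_cvg0; apply: norm_cvg0.
  apply: (@squeeze0 _ _ _ _ _ (fun n => M * `|u n - p|)) => [n|].
    by rewrite normr_ge0 -fN -fD fM.
  by rewrite -(mulr0 M); exact: cvgMl_tmp.
have Ju_cvg : (fun n => J (u n)) @ \oo --> J p.
  by apply: cvgB; [exact: cvg_dot|exact: cvgMl_tmp].
have Jp y : C y -> J p <= J y.
  move=> Cy; apply: (@le_trans _ _ e); last exact: eJ.
  have e_cvg : (fun n => e + n.+1%:R^-1) @ \oo --> e.
    by rewrite -[X in _ --> X]addr0; apply: cvgD; [exact: cvg_cst|exact: cvg_harmonic].
  apply: (ler_cvg_to Ju_cvg e_cvg); apply: nearW => n; exact: ltW.
move=> y Cy; rewrite leNgt; apply/negP => fQ.
set v := y - p in fQ; pose g := f v - dot (Q p) v.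
have g0 : 0 < g by rewrite subr_gt0.
have q0 : 0 <= dot (Q v) v by apply: le_trans (Qc v); rewrite mulr_ge0 ?sqr_ge0 ?ltW.
(* At this step the second-order term [t ^+ 2 * dot (Q v) v] is at most
   [t * g], half of the first-order gain; the [g] in the denominator keeps
   [t <= 1]. *)
pose t := g / (g + dot (Q v) v).
have gq : 0 < g + dot (Q v) v by rewrite ltr_pwDl.
have t0 : 0 < t by exact: divr_gt0.
have t1 : t <= 1 by rewrite /t ler_pdivrMr// mul1r lerDl.
have tq : t * dot (Q v) v <= g.
  by rewrite /t mulrAC ler_pdivrMr// ler_pM2l// lerDr ltW.
have := Jp _ (@convex_comb _ _ _ t Cconv Cp Cy _).
rewrite ltW// t1 => /(_ isT); rewrite -/v J_line.
have : t * (t * dot (Q v) v) <= t * g by rewrite ler_pM2l.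
have : 0 < t * g by exact: mulr_gt0.
have -> : dot (Q p) v - f v = - g by rewrite /g opprB.
by move: (J p) => Jp'; nra.
Qed.
End LaxMilgram.

Section Operators.
Context {R : realType} {H : completeNormedModType R} (dot : {dot H for idfun}).
Hypothesis hdot : norm_from_dot dot.
Implicit Types (x y z : H) (A U Q : {linear H -> H}).

Lemma dot_eqP x y : (forall v, dot x v = dot y v) -> x = y.
Proof.
move=> xy; apply: eq_of_dist_sqr_le0.
by rewrite -(dotxx hdot) dotDl dotNl xy subrr.
Qed.

Lemma lax_milgram Q (f : H -> R) (c K M : R) :
  self_adjoint dot Q -> 0 < c -> (forall x, c * `|x| ^+ 2 <= dot (Q x) x) ->
  (forall x, `|Q x| <= K * `|x|) ->
  (forall a x y, f (a *: x + y) = a * f x + f y) ->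
  (forall x, `|f x| <= M * `|x|) ->
  exists p, forall v, f v = dot (Q p) v.
Proof.
move=> Qsym c0 Qc QK flin fM.
have T0 : [set: H] !=set0 by exists 0.
have Tconv : convex_set [set: H] by move=> ? ? ?; rewrite !inE.
have [p _ pvi] := stampacchia hdot Qsym c0 Qc QK flin fM T0 closedT Tconv.
exists p => v; apply/eqP; rewrite eq_le.
have := pvi (p + v) I; rewrite addrC addKr => ->/=.
have := pvi (p - v) I; rewrite addrC addKr dotNr.
have := flin (-1) v 0; have := flin 1 0 0.
by rewrite scale1r !addr0 scaleN1r => f0 ->; lra.
Qed.

Lemma riesz (f : H -> R) (M : R) :
  (forall a x y, f (a *: x + y) = a * f x + f y) ->
  (forall x, `|f x| <= M * `|x|) -> exists p, forall v, f v = dot p v.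
Proof.
apply: (@lax_milgram idfun f 1 1 M) => // x.
  by rewrite mul1r dotxx.
by rewrite mul1r.
Qed.

(** Cauchy-Schwarz for the form of [A], between [x] and [A x]. *)
Lemma psd_norm_le A (K : R) x : self_adjoint dot A ->
  (forall z, 0 <= dot (A z) z) -> (forall z, dot (A z) z <= K * `|z| ^+ 2) ->
  `|A x| ^+ 2 <= K * dot (A x) x.
Proof.
move=> Asym A0 AK.
have := psd_CS x (A x) Asym A0; rewrite (dotxx hdot) => CS.
have {}CS : (`|A x| ^+ 2) ^+ 2 <= dot (A x) x * (K * `|A x| ^+ 2).
  by apply: le_trans CS _; rewrite ler_wpM2l.
have [->|Ax_neq0] := eqVneq (A x) 0; first by rewrite dot0l normr0 expr0n mulr0.
have Ax0 : 0 < `|A x| ^+ 2 by rewrite exprn_gt0 ?normr_gt0.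
rewrite -(ler_pM2l Ax0); move: CS; nra.
Qed.

Lemma opnorm_bound U x : bounded_near U (nbhs (0 : H)) ->
  `|U x| <= opnorm U * `|x|.
Proof.
move=> /linear_boundedP/pinfty_ex_gt0[r r0 Ur].
have ubU : has_ubound [set `|U x| | x in [set x : H | `|x| <= 1]].
  exists r => _ [z /= z1 <-]; apply: le_trans (Ur z) _.
  by rewrite ger_pMr.
have [->|x0] := eqVneq x 0; first by rewrite linear0 !normr0 mulr0.
have nx0 : 0 < `|x| by rewrite normr_gt0.
rewrite -ler_pdivrMr//; apply: ub_le_sup => //.
exists (`|x|^-1 *: x) => /=.
  by rewrite normrZ normfV normr_id mulVf ?gt_eqF.
by rewrite opZ normrZ normfV normr_id mulrC.
Qed.

Lemma opinvP U (alpha : R) : 0 < alpha -> Pcal dot alpha U ->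
  exists A, [/\ opinv U = A :> (H -> H), cancel A U, cancel U A & self_adjoint dot A].
Proof.
move=> alpha0 [Ubnd Usym Uge].
have Uc x : alpha * `|x| ^+ 2 <= dot (U x) x.
  by have := Uge x; rewrite /= dotZl (dotxx hdot).
have Ubound x := opnorm_bound x Ubnd.
have Uinj : injective U.
  move=> x y Uxy; apply: eq_of_dist_sqr_le0.
  have := Uc (x - y); rewrite opD opN Uxy subrr dot0l.
  by rewrite pmulr_rle0.
have Usurj z : exists x, U x = z.
  have [] := @lax_milgram U (dot z) alpha (opnorm U) `|z| Usym alpha0 Uc Ubound.
  - by move=> a x y; rewrite dotDr dotZr.
  - exact: dot_CS.
  - by move=> p zp; exists p; apply: dot_eqP => v; rewrite zp.
have invK : cancel (opinv U) U.
  move=> z; apply: (@pinvK _ _ (fun=> 0) [set: H] U).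
  by have [x <-] := Usurj z; rewrite inE; exists x.
have inv_lin : linear (opinv U).
  by move=> a x y; apply: Uinj; rewrite opD opZ !invK.
pose A : {linear H -> H} :=
  HB.pack (opinv U) (GRing.isLinear.Build R H H _ (opinv U) inv_lin).
exists A; split => // [x|x y]; first by apply: Uinj; rewrite invK.
by rewrite -{1}(invK y) -Usym invK.
Qed.

Section Inverse.
Variables (U A : {linear H -> H}) (alpha : R).
Hypotheses (alpha0 : 0 < alpha) (PU : Pcal dot alpha U) (AK : cancel A U).

Let Uge x : alpha * `|x| ^+ 2 <= dot (U x) x.
Proof. by have [_ _ /(_ x)] := PU; rewrite /= dotZl (dotxx hdot). Qed.

Lemma Pcal_ge0 x : 0 <= dot (U x) x.
Proof. by apply: le_trans (Uge x); rewrite mulr_ge0 ?sqr_ge0// ltW. Qed.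

Lemma inv_ge0 x : 0 <= dot (A x) x.
Proof. by rewrite -{2}(AK x) dotC; exact: Pcal_ge0. Qed.

Lemma inv_lower x : `|x| ^+ 2 <= opnorm U * dot (A x) x.
Proof.
have [Ubnd Usym _] := PU.
rewrite -{1}(AK x) -{3}(AK x) (dotC _ (A x)).
apply: psd_norm_le => // z; first exact: Pcal_ge0.
apply: le_trans (dot_le hdot _ _) _.
by rewrite expr2 mulrA ler_wpM2r// opnorm_bound.
Qed.

Lemma inv_upper x : dot (A x) x <= alpha^-1 * `|x| ^+ 2.
Proof.
have Ax : alpha * `|A x| ^+ 2 <= dot (A x) x.
  by rewrite (dotC _ _ x) -{2}(AK x).
rewrite ler_pdivlMl//.
have := dot_le hdot (A x) x.
set q := dot _ _ in Ax *; set s := `|A x| in Ax *; set t := `|x| => qst.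
have := ler_wpM2l (ltW alpha0) Ax; have := ler_wpM2l (ltW alpha0) qst.
by have := sqr_ge0 (t - alpha * s); lra.
Qed.

Lemma inv_norm x : self_adjoint dot A -> `|A x| <= alpha^-1 * `|x|.
Proof.
move=> Asym; rewrite -ler_sqr ?nnegrE ?mulr_ge0 ?invr_ge0 ?(ltW alpha0)//.
apply: le_trans (psd_norm_le x Asym inv_ge0 inv_upper) _.
by rewrite exprMn [alpha^-1 ^+ 2]expr2 -mulrA ler_pM2l ?invr_gt0// inv_upper.
Qed.

End Inverse.

(** Cauchy-Schwarz for the form of [U], between [A x] and [A' x]: since
    [U (A x) = x], it bounds the square of [dot (A' x) x] by [dot (A x) x] times
    [dot (U (A' x)) (A' x)], and the latter is at most [c * dot (A' x) x]. *)
Lemma inv_antimono U U' A A' (alpha c : R) : 0 < alpha -> 0 <= c ->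
  Pcal dot alpha U -> Pcal dot alpha U' -> cancel A U -> cancel A' U' ->
  loewner_ge dot (c \*: U') U ->
  forall x, dot (A' x) x <= c * dot (A x) x.
Proof.
move=> alpha0 c0 PU PU' AK AK' UU' x.
have [_ Usym _] := PU.
have := psd_CS (A x) (A' x) Usym (Pcal_ge0 alpha0 PU).
rewrite AK (dotC _ x (A' x)) (dotC _ x (A x)).
have := UU' (A' x); rewrite /= dotZl AK' (dotC _ x (A' x)) => le1 CS.
have q'0 := inv_ge0 alpha0 PU' AK' x; have q0 := inv_ge0 alpha0 PU AK x.
have {CS le1} : dot (A' x) x ^+ 2 <= dot (A x) x * (c * dot (A' x) x).
  by apply: le_trans CS _; rewrite ler_wpM2l.
move: (dot (A' x) x) (dot (A x) x) q'0 q0 => q' q q'0 q0.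
have [->|] := eqVneq q' 0; first by rewrite mulr_ge0.
rewrite neq_lt ltNge q'0/= => {}q'0.
by rewrite mulrCA mulrA -subr_ge0 expr2 -mulrBl pmulr_lge0// subr_ge0.
Qed.

End Operators.

(** * Projections in a variable metric *)

Section Metric.
Context {R : realType} {H : completeNormedModType R} (dot : {dot H for idfun}).
Hypothesis hdot : norm_from_dot dot.
Variables (U A : {linear H -> H}) (alpha : R).
Hypotheses (alpha0 : 0 < alpha) (PU : Pcal dot alpha U) (AK : cancel A U).
Hypotheses (UA : opinv U = A :> (H -> H)) (Asym : self_adjoint dot A).
Hypothesis U0 : 0 < opnorm U.
Implicit Types x y z : H.

Let q0 x : 0 <= dot (A x) x. Proof. exact: (inv_ge0 hdot alpha0 PU AK). Qed.

Lemma wnormE x : wnorm dot U x = Num.sqrt (dot (A x) x).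
Proof. by rewrite /wnorm UA. Qed.

Lemma wnorm_sqr x : wnorm dot U x ^+ 2 = dot (A x) x.
Proof. by rewrite wnormE sqr_sqrtr. Qed.

Lemma wnorm_ge0 x : 0 <= wnorm dot U x. Proof. exact: sqrtr_ge0. Qed.

Lemma wnorm_CS x y : dot (A x) y <= wnorm dot U x * wnorm dot U y.
Proof.
rewrite !wnormE -sqrtrM// (le_trans (ler_norm _))// -sqrtr_sqr ler_sqrt.
  exact: psd_CS.
by rewrite mulr_ge0.
Qed.

Lemma wnormD x y : wnorm dot U (x + y) <= wnorm dot U x + wnorm dot U y.
Proof.
rewrite -ler_sqr ?nnegrE ?addr_ge0 ?wnorm_ge0// wnorm_sqr.
rewrite (opD A) !dotE (Asym y x) (dotC _ y (A x)) sqrrD !wnorm_sqr.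
by have := wnorm_CS x y; lra.
Qed.

Lemma wnormZ a x : 0 <= a -> wnorm dot U (a *: x) = a * wnorm dot U x.
Proof.
move=> a0; rewrite !wnormE opZ !dotE mulrA -expr2 sqrtrM ?sqr_ge0//.
by rewrite sqrtr_sqr ger0_norm.
Qed.

Lemma wnorm_le_norm x : wnorm dot U x <= Num.sqrt alpha^-1 * `|x|.
Proof.
rewrite wnormE -[`|x|]normr_id -sqrtr_sqr -sqrtrM ?invr_ge0 ?(ltW alpha0)//.
by rewrite ler_sqrt ?(inv_upper hdot alpha0 PU AK)// mulr_ge0 ?sqr_ge0// invr_ge0 ltW.
Qed.

Section Projection.
Variables (C : set H).
Hypotheses (C0 : C !=set0) (Ccl : closed C) (Cconv : convex_set C).

(** [wproj] picks some minimizer of the distance. The point given by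
    [stampacchia] is one, and by Pythagoras the only one. *)
Lemma wprojP x (p := wproj dot U C x) :
  C p /\ forall y, C y -> dot (A (x - p)) (y - p) <= 0.
Proof.
have A_bnd z : `|A z| <= alpha^-1 * `|z| by exact: (inv_norm hdot alpha0 PU AK).
have A_coer z : (opnorm U)^-1 * `|z| ^+ 2 <= dot (A z) z.
  by rewrite ler_pdivrMl// (inv_lower hdot alpha0 PU AK).
have c0 : 0 < (opnorm U)^-1 by rewrite invr_gt0.
have A_lin a y z : dot (A x) (a *: y + z) = a * dot (A x) y + dot (A x) z.
  by rewrite dotDr dotZr.
have [p0 Cp0 p0P] := stampacchia hdot Asym c0 A_coer A_bnd A_lin
  (dot_CS hdot (A x)) C0 Ccl Cconv.
have p0V y : C y -> dot (A (x - p0)) (y - p0) <= 0.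
  by move=> /p0P; rewrite (opD A) (opN A) dotDl dotNl subr_le0.
have pyth y : C y -> dot (A (x - p0)) (x - p0) + dot (A (y - p0)) (y - p0) <=
    dot (A (x - y)) (x - y).
  move=> /p0V; have -> : x - y = (x - p0) - (y - p0) by rewrite opprB addrA subrK.
  move: (x - p0) (y - p0) => a b ab.
  by rewrite [A (a - b)](opD A) (opN A) !dotE (Asym b a) (dotC _ b (A a)); lra.
have argmin_p0 : exists p, C p /\ forall y, C y ->
    wnorm dot U (x - p) <= wnorm dot U (x - y).
  exists p0; split=> // y Cy; rewrite !wnormE ler_wsqrtr//.
  by apply: le_trans (pyth _ Cy); rewrite lerDl.
have [Cp pmin] : C p /\ forall y, C y ->
    wnorm dot U (x - p) <= wnorm dot U (x - y) by exact: xgetPex argmin_p0.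
suff -> : p = p0 by [].
have := pyth _ Cp; have := pmin _ Cp0.
rewrite -ler_sqr ?nnegrE ?wnorm_ge0// !wnorm_sqr => le1 le2.
have qp : dot (A (p - p0)) (p - p0) <= 0 by lra.
apply: eq_of_dist_sqr_le0; apply: le_trans (inv_lower hdot alpha0 PU AK _) _.
by rewrite pmulr_rle0.
Qed.

Lemma wproj_nonexpansive x y :
  wnorm dot U (wproj dot U C x - wproj dot U C y) <= wnorm dot U (x - y).
Proof.
have [Cp px] := wprojP x; have [Cq qy] := wprojP y.
set p := wproj _ _ _ x in Cp px *; set q := wproj _ _ _ y in Cq qy *.
have : dot (A (p - q)) (p - q) <= dot (A (x - y)) (p - q).
  have := px _ Cq; have := qy _ Cp.
  by rewrite !(opE A) !dotE; lra.
rewrite -wnorm_sqr => pq; have {pq} := le_trans pq (wnorm_CS _ _).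
rewrite expr2; have [->|] := eqVneq (wnorm dot U (p - q)) 0.
  by move=> _; exact: wnorm_ge0.
rewrite neq_lt ltNge wnorm_ge0/= => pq0.
by rewrite ler_pM2r.
Qed.
End Projection.
End Metric.

(** * The forward-backward step *)

Section Descent.
Context {R : realType} {H : completeNormedModType R} (dot : {dot H for idfun}).
Hypothesis hdot : norm_from_dot dot.
Implicit Types (A : {linear H -> H}) (h w d b : H) (beta gamma m : R).

(** In the application, [h = x - x*], [w] is the residual and [d = B x - B x*].
    The sum collects the defects of cocoercivity, of completing the square in
    [d], and of the lower bound of [A] by [1 / m]. *)
Definition gap A beta m h w d : R :=
  (dot h d - beta * `|d| ^+ 2) +
  (`|(2 * beta) *: d - w| ^+ 2 + (m * dot (A w) w - `|w| ^+ 2)) / (4 * beta).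

(** The two hypotheses are the variational inequalities of the projected point
    [x - w] and of the solution [x*], tested against each other; the defect of
    the conclusion is exactly the sum of theirs, [gamma] being the weight of the
    second. *)
Lemma fb_descent A h w b bs beta gamma m : 0 < beta -> 0 <= gamma ->
  dot (A w) (w - h) <= gamma * dot b (w - h) -> 0 <= dot bs (h - w) ->
  (1 - gamma * m / (4 * beta)) * dot (A w) w +
    gamma * gap A beta m h w (b - bs) <= dot (A w) h.
Proof.
move=> beta0 gamma0 hb hbs.
have {}hbs := mulr_ge0 gamma0 hbs.
rewrite -subr_ge0.
have -> : dot (A w) h - ((1 - gamma * m / (4 * beta)) * dot (A w) w +
    gamma * gap A beta m h w (b - bs)) =
  (gamma * dot b (w - h) - dot (A w) (w - h)) + gamma * dot bs (h - w).
  rewrite /gap -!(dotxx hdot) !dotE (dotC _ bs b) (dotC _ w b) (dotC _ w bs).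
  rewrite (dotC _ h b) (dotC _ h bs).
  by field; exact: lt0r_neq0.
by rewrite addr_ge0// subr_ge0.
Qed.

Lemma relaxed_dist A h w (lambda : R) : self_adjoint dot A ->
  dot (A (h - lambda *: w)) (h - lambda *: w) =
  dot (A h) h - 2 * lambda * dot (A w) h + lambda ^+ 2 * dot (A w) w.
Proof. by move=> Asym; rewrite !(opE A) !dotE (Asym h w) (dotC _ h); ring. Qed.

Lemma gap_parts A beta m h w d (g := gap A beta m h w d) : 0 < beta ->
  beta * `|d| ^+ 2 <= dot h d -> `|w| ^+ 2 <= m * dot (A w) w ->
  [/\ 0 <= g, dot h d - beta * `|d| ^+ 2 <= g,
      `|(2 * beta) *: d - w| ^+ 2 <= 4 * beta * g &
      m * dot (A w) w - `|w| ^+ 2 <= 4 * beta * g].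
Proof.
move=> beta0 L1 L3; have b4 : 0 < 4 * beta by lra.
have L2 := sqr_ge0 `|(2 * beta) *: d - w|.
have ge : 4 * beta * g = 4 * beta * (dot h d - beta * `|d| ^+ 2) +
  `|(2 * beta) *: d - w| ^+ 2 + (m * dot (A w) w - `|w| ^+ 2).
  by rewrite /g /gap; field; exact: lt0r_neq0.
have L1' : 0 <= 4 * beta * (dot h d - beta * `|d| ^+ 2).
  by rewrite pmulr_rge0// subr_ge0.
split; [|rewrite -(ler_pM2l b4)|..]; try lra.
by rewrite -(pmulr_rge0 _ b4); lra.
Qed.

(** The descent hypothesis bounds [m * dot (A w) h] below by
    [(2^-1 + kappa / 2) * `|w| ^+ 2], while replacing successively [m *: A w] by
    [w], [w] by [2 * beta *: d], and [dot h d] by [beta * `|d| ^+ 2] bounds it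
    above by [2^-1 * `|w| ^+ 2] up to errors controlled by the gap. *)
Lemma residual_le A beta gamma m eps D h w d (g := gap A beta m h w d)
    (kappa := eps / (2 * beta)) :
  self_adjoint dot A -> (forall z, `|z| ^+ 2 <= m * dot (A z) z) ->
  0 < beta -> 0 <= m -> 0 < eps -> gamma * m <= 2 * beta - eps ->
  beta * `|d| ^+ 2 <= dot h d ->
  (1 - gamma * m / (4 * beta)) * dot (A w) w <= dot (A w) h ->
  m * dot (A h) h <= D ->
  kappa / 4 * `|w| ^+ 2 <=
  (2 * beta + (2^-1 + kappa^-1) * (4 * beta)) * g + 2 * Num.sqrt (D * (4 * beta * g)).
Proof.
move=> Asym mA beta0 m0 eps0 gm dh wh hD.
have [g0 g1 g2 g3] := gap_parts beta0 dh (mA w); rewrite -/g in g0 g1 g2 g3.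
have k0 : 0 < kappa by rewrite divr_gt0// mulr_gt0.
set bg := 4 * beta * g in g2 g3 *.
have bg0 : 0 <= bg by rewrite !mulr_ge0// ltW.
have D0 : 0 <= D by apply: le_trans (le_trans (mA h) hD); exact: sqr_ge0.
have Dbg : 0 <= D * bg by exact: mulr_ge0.
have s0 := sqrtr_ge0 (D * bg).
pose s := `|(2 * beta) *: d - w|; have s_ge0 : 0 <= s := normr_ge0 _.
have sh : dot (w - (2 * beta) *: d) h <= Num.sqrt (D * bg).
  apply: le_trans (dot_le hdot _ _) _; rewrite distrC.
  rewrite -ler_sqr ?nnegrE ?mulr_ge0 ?sqrtr_ge0// sqr_sqrtr// exprMn mulrC.
  by apply: ler_pM; rewrite ?sqr_ge0// (le_trans (mA h)).
(* Cauchy-Schwarz for the nonnegative operator m A - 1: its form at [w] is part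
   of the gap, and at [h] it is at most [D]. *)
have Gwh : m * dot (A w) h - dot w h <= Num.sqrt (D * bg).
  have Gsym : self_adjoint dot (m \*: A \- idfun).
    by move=> a b /=; rewrite !dotE Asym.
  have Gpos z : 0 <= dot ((m \*: A \- idfun) z) z.
    by rewrite /= !dotE dotxx// subr_ge0.
  have := @psd_CS _ _ dot (m \*: A \- idfun) w h Gsym Gpos.
  rewrite /= !dotE !dotxx// => CS.
  rewrite (le_trans (ler_norm _))// -sqrtr_sqr ler_sqrt//.
  apply: le_trans CS _; rewrite mulrC; apply: ler_pM => //.
  - by rewrite subr_ge0.
  - by rewrite subr_ge0.
  - by have := sqr_ge0 `|h|; lra.
have wd : 2 * beta * (beta * `|d| ^+ 2) <= 2^-1 * (`|w| + s) ^+ 2.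
  have -> : 2 * beta * (beta * `|d| ^+ 2) = 2^-1 * `|(2 * beta) *: d| ^+ 2.
    by rewrite normrZ ger0_norm; [field|lra].
  rewrite ler_pM2l ?invr_gt0// ler_sqr ?nnegrE ?addr_ge0//.
  by rewrite -[X in `|X| <= _](subrK w) addrC ler_normD.
(* Young's inequality, leaving [kappa / 4] of the surplus [kappa / 2]. *)
have ws : `|w| * s <= kappa / 4 * `|w| ^+ 2 + kappa^-1 * s ^+ 2.
  have : 0 <= kappa^-1 * (kappa / 2 * `|w| - s) ^+ 2.
    by rewrite mulr_ge0 ?sqr_ge0 ?invr_ge0 ?ltW.
  have -> : kappa^-1 * (kappa / 2 * `|w| - s) ^+ 2 =
     kappa / 4 * `|w| ^+ 2 - `|w| * s + kappa^-1 * s ^+ 2.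
    by field; exact: lt0r_neq0.
  lra.
have main : (2^-1 + kappa / 2) * `|w| ^+ 2 <= m * dot (A w) h.
  have c0 : 2^-1 + kappa / 2 <= 1 - gamma * m / (4 * beta).
    rewrite -subr_ge0 (_ : _ - _ = (2 * beta - eps - gamma * m) / (4 * beta)).
      by rewrite divr_ge0 ?subr_ge0// ltW// mulr_gt0.
    by rewrite /kappa; field; exact: lt0r_neq0.
  apply: (@le_trans _ _ ((1 - gamma * m / (4 * beta)) * (m * dot (A w) w))).
    by apply: ler_pM; rewrite ?sqr_ge0//; lra.
  by rewrite mulrCA ler_wpM2l.
have s2 : (2^-1 + kappa^-1) * s ^+ 2 <= (2^-1 + kappa^-1) * bg.
  by rewrite ler_wpM2l// addr_ge0 ?invr_ge0// ltW.
have b1 : 2 * beta * (dot h d - beta * `|d| ^+ 2) <= 2 * beta * g.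
  by rewrite ler_pM2l// mulr_gt0.
move: sh; rewrite !dotE (dotC _ d h) => sh.
have -> : (2 * beta + (2^-1 + kappa^-1) * (4 * beta)) * g =
  2 * beta * g + (2^-1 + kappa^-1) * bg by rewrite /bg; ring.
by move: wd ws main s2 b1 sh Gwh; lra.
Qed.
End Descent.

(** * Quasi-Fejer sequences and strong convergence of the metrics *)

Section QuasiFejer.
Context {R : realType}.
Implicit Types (phi e eta : nat -> R).

Lemma growth_weights eta : (forall k, 0 <= eta k) -> cvgn (series eta) ->
  exists pi : nat -> R, [/\ forall k, 1 <= pi k,
    forall k, pi k.+1 = (1 + eta k) * pi k & cvgn pi].
Proof.
move=> eta0 eta_cvg; pose pi n := \prod_(i < n) (1 + eta i).
have piS k : pi k.+1 = (1 + eta k) * pi k by rewrite /pi big_ord_recr mulrC.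
have eta1 k : 1 <= 1 + eta k by rewrite lerDl.
have pi1 k : 1 <= pi k.
  elim: k => [|k IH]; first by rewrite /pi big_ord0.
  by rewrite piS; apply: (le_trans IH); rewrite ler_peMl// (le_trans _ IH).
exists pi; split=> //; apply: nondecreasing_is_cvgn.
  apply/nondecreasing_seqP => k; rewrite piS ler_peMl//.
  exact: le_trans (pi1 k).
have ser_nd := @nondecreasing_series _ eta xpredT 0%N (fun n _ _ => eta0 n).
exists (expR (limn (series eta))) => _ [n _ <-].
apply: (@le_trans _ _ (expR (series eta n))).
  rewrite seriesEord expR_sum; apply: ler_prod => i _.
  by rewrite expR_ge1Dx addr_ge0.
by rewrite ler_expR; apply: nondecreasing_cvgn_le.
Qed.

(** Dividing by the weights turns the perturbed inequality into a sequence
    that is nonincreasing up to a summable term. *)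
Lemma quasi_fejer phi e eta :
  (forall k, 0 <= phi k) -> (forall k, 0 <= e k) -> (forall k, 0 <= eta k) ->
  (forall k, phi k.+1 <= (1 + eta k) * (phi k + e k)) ->
  cvgn (series e) -> cvgn (series eta) -> cvgn phi.
Proof.
move=> phi0 e0 eta0 phiS e_cvg eta_cvg.
have [pi [pi1 piS pi_cvg]] := growth_weights eta0 eta_cvg.
have pi0 k : 0 < pi k by exact: lt_le_trans (pi1 k).
have ser_nd := @nondecreasing_series _ e xpredT 0%N (fun n _ _ => e0 n).
pose psi k := phi k / pi k - series e k.
have psi_cvg : cvgn psi.
  apply: nonincreasing_is_cvgn.
    apply/nonincreasing_seqP => k; rewrite /psi seriesSr.
    have eta1 : 0 < 1 + eta k by rewrite ltr_pwDl.
    have : phi k.+1 / pi k.+1 <= phi k / pi k + e k / pi k.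
      rewrite -mulrDl piS ler_pdivrMr ?mulr_gt0// mulrCA divfK ?gt_eqF//.
    have : e k / pi k <= e k by rewrite ler_pdivrMr// ler_peMr.
    by lra.
  exists (- limn (series e)) => _ [k _ <-]; rewrite /psi.
  have ser_le : series e k <= limn (series e) by exact: nondecreasing_cvgn_le.
  have : 0 <= phi k / pi k by rewrite divr_ge0// ltW.
  by lra.
rewrite (_ : phi = (fun k => (psi k + series e k) * pi k)).
  by apply: is_cvgM => //; exact: is_cvgD.
by apply/funext => k; rewrite /psi subrK divfK// gt_eqF.
Qed.

End QuasiFejer.

Section Vigier.
Context {R : realType} {H : completeNormedModType R} (dot : {dot H for idfun}).
Hypothesis hdot : norm_from_dot dot.

(** Divided by the weights of [growth_weights], the quadratic forms decrease,
    hence converge; and [psd_norm_le], applied to the difference of two rescaled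
    operators, turns this into a Cauchy estimate in norm. *)
Lemma strong_limit (A : nat -> {linear H -> H}) (eta : nat -> R) (K : R) z : 0 <= K ->
  (forall k, self_adjoint dot (A k)) ->
  (forall k x, 0 <= dot (A k x) x) ->
  (forall k x, dot (A k x) x <= K * `|x| ^+ 2) ->
  (forall k x, dot (A k.+1 x) x <= (1 + eta k) * dot (A k x) x) ->
  (forall k, 0 <= eta k) -> cvgn (series eta) -> cvgn (fun k => A k z).
Proof.
move=> K0 Asym A0 AK AS eta0 eta_cvg.
have [pi [pi1 piS pi_cvg]] := growth_weights eta0 eta_cvg.
have pi0 k : 0 < pi k by exact: lt_le_trans (pi1 k).
pose B k : {linear H -> H} := (pi k)^-1 \*: A k.
pose t x k := dot (B k x) x.
have t_ni x : {homo t x : m n / (m <= n)%N >-> n <= m}.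
  apply/nonincreasing_seqP => k; rewrite /t/= !dotZl piS.
  have eta1 : 0 < 1 + eta k by rewrite ltr_pwDl.
  by rewrite ler_pdivrMl ?mulr_gt0// -mulrA mulVKf ?gt_eqF.
have t0 x k : 0 <= t x k by rewrite /t/= dotZl mulr_ge0// invr_ge0 ltW.
have t_cvg : cvgn (t z).
  apply: nonincreasing_is_cvgn; first exact: t_ni.
  by exists 0 => _ [k _ <-].
have B_cvg : cvgn (fun k => B k z).
  apply: (@cauchy_dist_sqr _ _ _ (fun k => K * (t z k - limn (t z)))).
    move=> m n mn.
    have Esym : self_adjoint dot (B m \- B n).
      by move=> x y; rewrite /= !dotE !Asym.
    have E0 x : 0 <= dot ((B m \- B n) x) x.
      by have := t_ni x _ _ mn; rewrite /t /= !dotE; lra.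
    have EK x : dot ((B m \- B n) x) x <= K * `|x| ^+ 2.
      rewrite /= dotDl dotNl -/(t x n) -/(t x m).
      have : t x m <= dot (A m x) x.
        by rewrite /t/= dotZl ler_piMl// invf_le1.
      by have := AK m x; have := t0 x n; lra.
    apply: le_trans (psd_norm_le hdot z Esym E0 EK) _.
    rewrite ler_wpM2l//= dotDl dotNl -/(t z n) -/(t z m) lerD2l lerN2.
    exact: nonincreasing_cvgn_ge (t_ni z) t_cvg n.
  rewrite -(mulr0 K); apply: cvgMl_tmp.
  by apply/subr_cvg0.
rewrite (_ : (fun k => A k z) = (fun k => pi k *: B k z)).
  exact: is_cvgZ.
by apply/funext => k; rewrite /= scalerA divff ?scale1r// gt_eqF.
Qed.
End Vigier.

(** * Weak limits along ultrafilters *)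

Section Weak.
Context {R : realType} {H : completeNormedModType R} (dot : {dot H for idfun}).
Hypothesis hdot : norm_from_dot dot.

Lemma ultra_cvg_bounded {T} (G : set_system T) (f : T -> R) (M : R) :
  UltraFilter G -> (forall t, `|f t| <= M) ->
  exists2 c, `|c| <= M & f @ G --> c.
Proof.
move=> UG fM.
have GM : G (f @^-1` `[- M, M]%classic).
  by apply: filterS filterT => t _; rewrite /= in_itv/= -ler_norml.
have [c [cM clc]] := @segment_compact R (- M) M (f @ G) _ GM.
exists c; first by move: cM; rewrite /= in_itv/= -ler_norml.
move=> V Vc; have [//|GV] := in_ultra_setVsetC (f @^-1` V) UG.
have [z [/= nVz Vz]] := clc (~` V) V GV Vc.
by [].
Qed.

(** Along an ultrafilter all the bounded functions [dot (u _) v] converge at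
    once, and their limits are linear and bounded in [v]. *)
Lemma weak_ultra_limit {T} (G : set_system T) (u : T -> H) (D : R) :
  UltraFilter G -> (forall t, `|u t| <= D) ->
  exists p, forall v, (fun t => dot (u t) v) @ G --> dot p v.
Proof.
move=> UG uD.
have /choice[f fP] : forall v, exists c,
    `|c| <= D * `|v| /\ (fun t => dot (u t) v) @ G --> c.
  move=> v.
  have [|c cM cG] := @ultra_cvg_bounded _ G (fun t => dot (u t) v) (D * `|v|) UG.
    by move=> t; rewrite (le_trans (dot_CS hdot _ _))// ler_wpM2r.
  by exists c.
have [||p fp] := @riesz _ _ dot hdot f D.
- move=> a x y.
  have E : (fun t => dot (u t) (a *: x + y)) =
           (fun t => a * dot (u t) x + dot (u t) y).
    by apply/funext => t; rewrite dotDr dotZr.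
  have [_ fxy] := fP (a *: x + y); rewrite E in fxy.
  apply: (cvg_unique _ fxy); first exact: Rhausdorff.
  by apply: cvgD; [apply: cvgMl_tmp|]; exact: (fP _).2.
- by move=> v; exact: (fP v).1.
by exists p => v; rewrite -fp; exact: (fP v).2.
Qed.

(** If the inner products with [v] fail to converge, the indices where they stay
    [e] away from [dot p v] belong to some ultrafilter finer than [\oo]. *)
Lemma weakly_cvg_ultra (u : nat -> H) p :
  (forall G, UltraFilter G -> \oo `<=` G ->
    forall v, (fun t => dot (u t) v) @ G --> dot p v) -> weakly_cvg dot u p.
Proof.
move=> uG v; apply/cvgrPdist_lt => e e0; apply: contrapT => nnear.
pose S := [set k | ~ `|dot p v - dot (u k) v| < e].
have PS : ProperFilter (within S \oo).
  split; last exact: within_filter.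
  move=> S0; apply: nnear.
  have {}S0 : \forall k \near \oo, S k -> False by exact: S0.
  by apply: filterS S0 => k /= Sk; exact: contrapT.
have [G [UG SG]] := ultraFilterLemma PS.
have ooG : \oo `<=` G.
  by move=> A oA; apply: SG; apply: filterS oA => k Ak _.
have GS : G S by apply: SG; exact: withinT.
have /cvgrPdist_lt/(_ e e0) Ge := uG G UG ooG v.
by have [k []] := filter_ex (filterI GS Ge).
Qed.

Lemma cvg_dot_weak {T} {F : set_system T} {FF : Filter F} (u v : T -> H)
    (q c : H) (D : R) : (forall t, `|u t| <= D) ->
  (forall w, (fun t => dot (u t) w) @ F --> dot q w) -> v @ F --> c ->
  (fun t => dot (u t) (v t)) @ F --> dot q c.
Proof.
move=> uD uq vc.
have -> : (fun t => dot (u t) (v t)) =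
    (fun t => dot (u t) (v t - c) + dot (u t) c).
  by apply/funext => t; rewrite dotDr dotNr subrK.
rewrite -[X in _ --> X]add0r; apply: cvgD => //; apply: norm_cvg0.
apply: (@squeeze0 _ _ _ _ _ (fun t => D * `|v t - c|)) => [t|].
  by rewrite normr_ge0 (le_trans (dot_CS hdot _ _))// ler_wpM2r.
rewrite -(mulr0 D); apply: cvgMl_tmp; rewrite -(@normr0 _ H).
by apply: cvg_norm; apply/subr_cvg0.
Qed.

(** The limit equals its projection on [C]. *)
Lemma weakly_closed {F : set_system nat} {FF : ProperFilter F} (C : set H)
    (u : nat -> H) q : C !=set0 -> closed C -> convex_set C ->
  (forall t, C (u t)) -> (forall v, (fun t => dot (u t) v) @ F --> dot q v) ->
  C q.
Proof.
move=> C0 Ccl Cconv Cu uq.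
have id_sym : self_adjoint dot (@idfun H) by [].
have id_coer z : 1 * `|z| ^+ 2 <= dot (@idfun H z) z by rewrite mul1r dotxx.
have id_bnd z : `|@idfun H z| <= 1 * `|z| by rewrite mul1r.
have q_lin c v w : dot q (c *: v + w) = c * dot q v + dot q w.
  by rewrite dotDr dotZr.
have [q' Cq' q'P] := @stampacchia _ _ _ hdot idfun _ _ _ _ _ id_sym ltr01 id_coer
  id_bnd q_lin (dot_CS hdot q) C0 Ccl Cconv.
suff -> : q = q' by [].
have le0 : dot q (q - q') - dot q' (q - q') <= 0.
  have ucvg : (fun t => dot (u t) (q - q') - dot q' (q - q')) @ F -->
      dot q (q - q') - dot q' (q - q') by apply: cvgB; [exact: uq|exact: cvg_cst].
  have cst0 : (fun=> 0 : R) @ F --> (0 : R) by exact: cvg_cst.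
  apply: (ler_cvg_to ucvg cst0); apply: nearW => t /=.
  have := q'P _ (Cu t).
  by rewrite /= !dotE (dotC _ q q') (dotC _ (u t) q) (dotC _ (u t) q'); lra.
by apply: eq_of_dist_sqr_le0; rewrite -(dotxx hdot) dotDl dotNl.
Qed.

End Weak.

Lemma cvg_finer {T} {V : topologicalType} (F G : set_system T) (f : T -> V) (l : V) :
  F `<=` G -> f @ F --> l -> f @ G --> l.
Proof. by move=> FG fl W /fl; exact: FG. Qed.

(** * The perturbed relaxed iteration *)

Section Iteration.
Context {R : realType} {H : completeNormedModType R} (dot : {dot H for idfun}).
Hypothesis hdot : norm_from_dot dot.
Variables (C : set H) (B : H -> H) (alpha beta lambda_ gamma_ eps mu : R).
Variables (U A : nat -> {linear H -> H}) (eta gamma lambda : nat -> R).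
Variables (a b x y : nat -> H).
Hypotheses (C0 : C !=set0) (Ccl : closed C) (Cconv : convex_set C).
Hypotheses (alpha0 : 0 < alpha) (beta0 : 0 < beta) (lambda0 : 0 < lambda_).
Hypotheses (gamma0 : 0 < gamma_) (eps0 : 0 < eps).
Hypotheses (Bcoco : cocoercive dot beta B).
Hypotheses (PU : forall k, Pcal dot alpha (U k)).
Hypotheses (UA : forall k, opinv (U k) = A k :> (H -> H)).
Hypotheses (AK : forall k, cancel (A k) (U k)) (KA : forall k, cancel (U k) (A k)).
Hypothesis Asym : forall k, self_adjoint dot (A k).
Hypotheses (m0 : forall k, 0 < opnorm (U k)) (m_mu : forall k, opnorm (U k) <= mu).
Hypotheses (eta0 : forall k, 0 <= eta k) (eta_cvg : cvgn (series eta)).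
Hypothesis Ueta : forall k, loewner_ge dot ((1 + eta k) \*: U k.+1) (U k).
Hypothesis gamma_ge : forall k, gamma_ <= gamma k.
Hypothesis gamma_le : forall k, gamma k * opnorm (U k) <= 2 * beta - eps.
Hypothesis lambda_ge : forall k, lambda_ <= lambda k.
Hypothesis lambda_le : forall k,
  lambda k <= 2 - gamma k * opnorm (U k) / (2 * beta).
Hypothesis a_cvg : cvgn (series (fun k => lambda k * `|a k|)).
Hypothesis b_cvg : cvgn (series (fun k => lambda k * `|b k|)).
Hypothesis y_def : forall k, y k = x k - gamma k *: U k (B (x k) + b k).
Hypothesis x_rec : forall k,
  x k.+1 = x k + lambda k *: (wproj dot (U k) C (y k) + a k - x k).

Let m k := opnorm (U k).
Let N k := wnorm dot (U k).
Let p k := wproj dot (U k) C (x k - gamma k *: U k (B (x k))).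
Let w k := x k - p k.
Let z k := x k - lambda k *: w k.

Let lambda_gt0 k : 0 < lambda k. Proof. exact: lt_le_trans (lambda_ge k). Qed.
Let gamma_gt0 k : 0 < gamma k. Proof. exact: lt_le_trans (gamma_ge k). Qed.
Let mu0 : 0 < mu. Proof. exact: lt_le_trans (m0 0) (m_mu 0). Qed.
Let Nsqr k v : N k v ^+ 2 = dot (A k v) v.
Proof. exact: (wnorm_sqr hdot alpha0 (PU k) (AK k) (UA k)). Qed.
Let Nge0 k v : 0 <= N k v. Proof. exact: wnorm_ge0. Qed.
Let mA k v : `|v| ^+ 2 <= m k * dot (A k v) v.
Proof. exact: (inv_lower hdot alpha0 (PU k) (AK k)). Qed.

Let Cp k : C (p k).
Proof.
by have [] := wprojP hdot alpha0 (PU k) (AK k) (UA k) (Asym k) (m0 k) C0 Ccl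
  Cconv (x k - gamma k *: U k (B (x k))).
Qed.

Lemma residual_VI k v : C v ->
  dot (A k (w k)) (v - p k) <= gamma k * dot (B (x k)) (v - p k).
Proof.
move=> Cv.
have [_ /(_ v Cv)] := wprojP hdot alpha0 (PU k) (AK k) (UA k) (Asym k) (m0 k)
  C0 Ccl Cconv (x k - gamma k *: U k (B (x k))).
rewrite -/(p k) addrAC (opD (A k)) (opN (A k)) (opZ (A k)) KA dotDl dotNl dotZl.
by rewrite subr_le0.
Qed.

Let e k := Num.sqrt alpha^-1 * (2 * beta * (lambda k * `|b k|) + lambda k * `|a k|).

(** The projection is nonexpansive in the metric, and [gamma k] times the norm
    of [U k] is at most [2 * beta]. *)
Lemma error_le k : N k (x k.+1 - z k) <= e k.
Proof.
have -> : x k.+1 - z k = lambda k *: ((wproj dot (U k) C (y k) - p k) + a k).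
  rewrite x_rec /z opprB [LHS]addrC addrA subrK -scalerDr /w.
  by rewrite addrC addrA subrK addrAC.
have l0 := ltW (lambda_gt0 k); have gm : gamma k * opnorm (U k) <= 2 * beta.
  by apply: le_trans (gamma_le k) _; rewrite gerBl ltW.
rewrite /N (wnormZ dot (UA k)) // /e.
have sa0 : 0 <= Num.sqrt alpha^-1 := sqrtr_ge0 _.
apply: (@le_trans _ _ (lambda k * (Num.sqrt alpha^-1 * (2 * beta * `|b k| + `|a k|)))); last first.
  by rewrite le_eqVlt; apply/orP; left; apply/eqP; ring.
rewrite ler_pM2l// mulrDr.
apply: le_trans (wnormD hdot alpha0 (PU k) (AK k) (UA k) (Asym k) _ _) _.
apply: lerD; last exact: (wnorm_le_norm hdot alpha0 (PU k) (AK k) (UA k)).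
apply: le_trans (wproj_nonexpansive hdot alpha0 (PU k) (AK k) (UA k) (Asym k)
  (m0 k) C0 Ccl Cconv _ _) _.
apply: le_trans (wnorm_le_norm hdot alpha0 (PU k) (AK k) (UA k) _) _.
rewrite ler_wpM2l// y_def opprB addrC addrA subrK -scalerBr.
rewrite -opN -opD opprD addrA subrr add0r opN scalerN normrN normrZ gtr0_norm//.
apply: le_trans (_ : gamma k * (opnorm (U k) * `|b k|) <= _).
  by rewrite ler_pM2l//; apply: opnorm_bound; have [] := PU k.
by rewrite mulrA ler_wpM2r.
Qed.

Lemma metric_step k v : N k.+1 v <= (1 + eta k) * N k v.
Proof.
have eta1 : 1 <= 1 + eta k by rewrite lerDl.
rewrite -ler_sqr ?nnegrE ?mulr_ge0 ?(le_trans _ eta1)// exprMn !Nsqr.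
apply: le_trans (inv_antimono hdot alpha0 _ (PU k) (PU k.+1) (AK k) (AK k.+1) (Ueta k) v) _.
  by rewrite (le_trans _ eta1).
rewrite ler_wpM2r//; first by rewrite -Nsqr sqr_ge0.
by rewrite expr2 ler_peMl// (le_trans _ eta1).
Qed.

Section Solution.
Variables (xs : H) (Oxs : VI_solutions dot C B xs).

Let h k := x k - xs.
Let d k := B (x k) - B xs.
Let g k := gap dot (A k) beta (m k) (h k) (w k) (d k).

Let coco k : beta * `|d k| ^+ 2 <= dot (h k) (d k).
Proof. exact: Bcoco. Qed.

Let parts k := gap_parts beta0 (coco k) (mA k (w k)).

Let descent k : (1 - gamma k * m k / (4 * beta)) * dot (A k (w k)) (w k) +
  gamma k * g k <= dot (A k (w k)) (h k).
Proof.
have [Cxs xsP] := Oxs; have wh : w k - h k = xs - p k.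
  by rewrite /w /h opprB addrC addrA subrK.
apply: fb_descent => //; first exact: ltW.
  by rewrite wh; exact: residual_VI.
by rewrite -opprB wh opprB; exact: xsP.
Qed.

(** By [lambda_le], the term in [lambda k ^+ 2] of [relaxed_dist] is at most what
    the first term of [descent] removes, so the gap is left as net decrease. *)
Lemma fejer_step k :
  N k (z k - xs) ^+ 2 <= N k (x k - xs) ^+ 2 - 2 * (lambda_ * gamma_) * g k.
Proof.
have -> : z k - xs = h k - lambda k *: w k by rewrite /z addrAC.
rewrite !Nsqr relaxed_dist//.
have q0 : 0 <= dot (A k (w k)) (w k) by rewrite -Nsqr sqr_ge0.
have [g0 _ _ _] := parts k; rewrite -/(g k) in g0.
have lg : lambda_ * gamma_ <= lambda k * gamma k by rewrite ler_pM// ltW.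
have := ler_wpM2r g0 lg.
have := ler_wpM2l (ltW (lambda_gt0 k)) (descent k).
have := ler_wpM2l (ltW (lambda_gt0 k)) (ler_wpM2r q0 (lambda_le k)).
rewrite -/(m k) -/(h k).
have -> : gamma k * m k / (4 * beta) = gamma k * m k / (2 * beta) / 2.
  by field; exact: lt0r_neq0.
by move: (gamma k * m k / (2 * beta)) => c; lra.
Qed.

Let psi_le k : N k (z k - xs) <= N k (x k - xs).
Proof.
rewrite -ler_sqr ?nnegrE//; apply: le_trans (fejer_step k) _.
have [g0 _ _ _] := parts k.
by rewrite gerBl mulr_ge0// mulr_ge0// mulr_ge0// ltW.
Qed.

Let e_ge0 k : 0 <= e k. Proof. exact: le_trans (error_le k). Qed.

Let e_cvg : cvgn (series e).
Proof.
have -> : e = Num.sqrt alpha^-1 *: ((2 * beta) *: (fun k => lambda k * `|b k|) +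
    (fun k => lambda k * `|a k|)).
  by apply/funext.
apply: is_cvg_seriesZ; apply: is_cvg_seriesD => //.
exact: is_cvg_seriesZ.
Qed.

Let perturbed_step k :
  N k.+1 (x k.+1 - xs) <= (1 + eta k) * (N k (z k - xs) + e k).
Proof.
apply: le_trans (metric_step _ _) _; rewrite ler_pM2l ?ltr_pwDl//.
have -> : x k.+1 - xs = (z k - xs) + (x k.+1 - z k) by rewrite [RHS]addrC addrA subrK.
apply: le_trans (wnormD hdot alpha0 (PU k) (AK k) (UA k) (Asym k) _ _) _.
by rewrite lerD2l error_le.
Qed.

Lemma dist_cvg : cvgn (fun k => N k (x k - xs)).
Proof.
apply: quasi_fejer e_cvg eta_cvg => // k.
apply: le_trans (perturbed_step k) _.
by rewrite ler_pM2l ?ltr_pwDl// lerD2r psi_le.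
Qed.

(** The distances before and after the exact relaxed step [z k] have the same
    limit, and [fejer_step] bounds the gap by the difference of their squares. *)
Lemma gap_cvg0 : g @ \oo --> (0 : R).
Proof.
have N_cvg := dist_cvg; set l := limn _ in N_cvg.
have e_cvg0 := cvg_series_cvg_0 e_cvg.
have eta_cvg0 := cvg_series_cvg_0 eta_cvg.
have psi_cvg : (fun k => N k (z k - xs)) @ \oo --> l.
  apply: (@squeeze_cvgr _ _ _ _ (fun k => N k.+1 (x k.+1 - xs) / (1 + eta k) - e k)
    (fun k => N k (x k - xs))) => //.
    apply: nearW => k; rewrite psi_le andbT lerBlDr ler_pdivrMr ?ltr_pwDl//.
    by rewrite mulrC.
  have -> : l = l / (1 + 0) - 0 by rewrite addr0 divr1 subr0.
  apply: cvgB => //; apply: cvgM; first by rewrite (cvg_shiftS (fun k => N k (x k - xs))).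
  apply: cvgV; first by rewrite addr0 oner_neq0.
  by apply: cvgD => //; exact: cvg_cst.
pose K := (2 * (lambda_ * gamma_))^-1.
apply: (@squeeze0 _ _ _ _ _ (fun k => K * (N k (x k - xs) ^+ 2 - N k (z k - xs) ^+ 2))).
  move=> k; have [-> _ _ _/=] := parts k.
  rewrite ler_pdivlMl; first by have := fejer_step k; lra.
  by rewrite !mulr_gt0.
have -> : 0 = K * (l ^+ 2 - l ^+ 2) by rewrite subrr mulr0.
by apply: cvgMl_tmp; apply: cvgB; exact: cvg_sqr.
Qed.

Lemma iterates_bounded :
  exists2 D, 0 <= D & forall k, m k * dot (A k (h k)) (h k) <= D.
Proof.
have [M [Mr NM]] := cvg_seq_bounded dist_cvg.
have M1 : M < M + 1 by rewrite ltrDl.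
have NM1 k : N k (x k - xs) <= M + 1 := le_trans (ler_norm _) (NM _ M1 k I).
exists (mu * (M + 1) ^+ 2) => [|k].
  by rewrite mulr_ge0 ?sqr_ge0// ltW.
rewrite -Nsqr; apply: ler_pM => //; first exact: ltW (m0 k).
  exact: sqr_ge0.
  exact: m_mu.
by rewrite ler_sqr ?nnegrE// (le_trans _ (NM1 k)).
Qed.

Lemma residual_cvg0 : (fun k => `|w k|) @ \oo --> (0 : R).
Proof.
have [D D0 hD] := iterates_bounded.
pose kappa := eps / (2 * beta).
have k0 : 0 < kappa by rewrite divr_gt0// mulr_gt0.
have w2 : (fun k => `|w k| ^+ 2) @ \oo --> (0 : R).
  pose F k := (kappa / 4)^-1 * ((2 * beta + (2^-1 + kappa^-1) * (4 * beta)) * g k +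
    2 * Num.sqrt (D * (4 * beta * g k))).
  apply: (@squeeze0 _ _ _ _ _ F) => [k|].
    rewrite sqr_ge0/= ler_pdivlMl ?divr_gt0 ?mulr_gt0//.
    have wh : (1 - gamma k * m k / (4 * beta)) * dot (A k (w k)) (w k) <=
        dot (A k (w k)) (h k).
      apply: le_trans (descent k); rewrite lerDl mulr_ge0//; first exact: ltW.
      by have [] := parts k.
    by have := residual_le hdot (Asym k) (mA k) beta0 (ltW (m0 k)) eps0 (gamma_le k)
      (coco k) wh (hD k).
  have := gap_cvg0 => g_cvg.
  have sq : (fun k => Num.sqrt (D * (4 * beta * g k))) @ \oo --> (0 : R).
    apply: cvg_sqrt0; rewrite -(mulr0 D) -(mulr0 (4 * beta)).
    by do 2 apply: cvgMl_tmp.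
  have -> : 0 = (kappa / 4)^-1 * ((2 * beta + (2^-1 + kappa^-1) * (4 * beta)) * 0 + 2 * 0).
    by rewrite !mulr0 addr0 mulr0.
  by apply: cvgMl_tmp; apply: cvgD; exact: cvgMl_tmp.
have : (fun k => `| (`|w k|) |) @ \oo --> (0 : R) by exact: cvg_sqr0.
by under eq_fun do rewrite normr_id.
Qed.

Lemma B_cvg : (fun k => B (x k)) @ \oo --> B xs.
Proof.
have w0 := residual_cvg0; have g_cvg := gap_cvg0.
apply: (@cvg_dist_sqr0 _ _ _ _ _ _ _
   (fun k => (2 * beta ^+ 2)^-1 * (`|w k| ^+ 2 + 4 * beta * g k))).
  move=> k; rewrite -/(d k) ler_pdivlMl ?mulr_gt0 ?exprn_gt0//.
  have [_ _ g2 _] := parts k; rewrite -/(g k) in g2.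
  have : `|(2 * beta) *: d k| <= `|w k| + `|(2 * beta) *: d k - w k|.
    by rewrite -[X in `|X| <= _](subrK (w k)) addrC ler_normD.
  rewrite normrZ ger0_norm; last by rewrite mulr_ge0// ltW.
  have := normr_ge0 (w k); have := normr_ge0 ((2 * beta) *: d k - w k).
  move: (`|w k|) (`|(2 * beta) *: d k - w k|) g2 => s t g2 t0 s0 st.
  have : (2 * beta * `|d k|) ^+ 2 <= (s + t) ^+ 2.
    by rewrite ler_sqr ?nnegrE ?addr_ge0// mulr_ge0// mulr_ge0// ltW.
  have := sqr_ge0 (s - t); nra.
have -> : 0 = (2 * beta ^+ 2)^-1 * (0 ^+ 2 + 4 * beta * 0).
  by rewrite mulr0 addr0 expr0n mulr0.
by apply: cvgMl_tmp; apply: cvgD; [exact: cvg_sqr|exact: cvgMl_tmp].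
Qed.

Lemma iterates_norm_bounded : exists D, forall k, `|x k| <= D.
Proof.
have [D D0 hD] := iterates_bounded.
exists (Num.sqrt D + `|xs|) => k; rewrite -[x k](subrK xs).
apply: le_trans (ler_normD _ _) _; rewrite lerD2r.
rewrite -ler_sqr ?nnegrE ?sqrtr_ge0// sqr_sqrtr//.
exact: le_trans (mA k _) (hD k).
Qed.

(** Cocoercivity between [x k] and [q] passes to the limit and gives
    [B q = B xs]. The inequality at [q] is the limit of [residual_VI], where
    [dot (A k (w k)) (w k) >= 0] is dropped so that only the bounded sequence
    [x] is paired with the strongly vanishing residual. *)
Lemma weak_cluster_solution (G : set_system nat) q : UltraFilter G ->
  \oo `<=` G -> (forall v, (fun k => dot (x k) v) @ G --> dot q v) ->
  VI_solutions dot C B q.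
Proof.
move=> UG ooG xq.
have [D xD] := iterates_norm_bounded.
have w0 : w @ G --> (0 : H) by apply: (cvg_finer ooG); exact: norm_cvg0 residual_cvg0.
have Bx : (fun k => B (x k)) @ G --> B xs by apply: (cvg_finer ooG); exact: B_cvg.
have Bq : B q = B xs.
  have Bd : (fun k => B (x k) - B q) @ G --> B xs - B q.
    by apply: cvgB => //; exact: cvg_cst.
  have lhs : (fun k => beta * `|B (x k) - B q| ^+ 2) @ G --> beta * `|B xs - B q| ^+ 2.
    by apply: cvgMl_tmp; apply: cvg_sqr; exact: cvg_norm.
  have rhs : (fun k => dot (x k) (B (x k) - B q) - dot q (B (x k) - B q)) @ G -->
      dot q (B xs - B q) - dot q (B xs - B q).
    apply: cvgB; first exact: cvg_dot_weak xD xq Bd.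
    by apply: (cvg_dot hdot) => //; exact: cvg_cst.
  have : beta * `|B xs - B q| ^+ 2 <= dot q (B xs - B q) - dot q (B xs - B q).
    apply: (ler_cvg_to lhs rhs); apply: nearW => k.
    by have := Bcoco (x k) q; rewrite dotDl dotNl.
  by rewrite subrr pmulr_rle0// => /eq_of_dist_sqr_le0.
split.
  apply: (@weakly_closed _ _ _ hdot G _ C p) => // v.
  have -> : (fun k => dot (p k) v) = (fun k => dot (x k) v - dot (w k) v).
    by apply/funext => k; rewrite /w !dotE; ring.
  rewrite -[X in _ --> X]subr0 -(dot0l dot v); apply: cvgB => //.
  by apply: (cvg_dot hdot) => //; exact: cvg_cst.
move=> v Cv; rewrite Bq.
pose r k := (gamma k)^-1 *: A k (w k).
have r0 : r @ G --> (0 : H).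
  apply: norm_cvg0.
  apply: (@squeeze0 _ _ _ _ _ (fun k => gamma_^-1 * alpha^-1 * `|w k|)) => [k|].
    rewrite normr_ge0 normrZ gtr0_norm ?invr_gt0// -mulrA; apply: ler_pM => //.
    - by rewrite invr_ge0 ltW.
    - by rewrite lef_pV2 ?posrE.
    - exact: (inv_norm hdot alpha0 (PU k) (AK k)).
  rewrite -(mulr0 (gamma_^-1 * alpha^-1)); apply: cvgMl_tmp.
  exact: (cvg_finer ooG residual_cvg0).
have lhs : (fun k => dot (r k) v - dot (x k) (r k)) @ G --> dot 0 v - dot q 0.
  apply: cvgB; first by apply: (cvg_dot hdot) => //; exact: cvg_cst.
  exact: cvg_dot_weak xD xq r0.
have rhs : (fun k => dot (B (x k)) v - dot (x k) (B (x k)) + dot (B (x k)) (w k)) @ G -->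
    dot (B xs) v - dot q (B xs) + dot (B xs) 0.
  apply: cvgD; last exact: cvg_dot.
  apply: cvgB; first by apply: (cvg_dot hdot) => //; exact: cvg_cst.
  exact: cvg_dot_weak xD xq Bx.
rewrite dotDr dotNr (dotC _ _ q).
have := ler_cvg_to lhs rhs; rewrite dot0l !dot0r subr0 addr0; apply.
apply: nearW => k.
have pk : p k = x k - w k by rewrite /w opprB addrC subrK.
have := residual_VI k Cv; rewrite -ler_pdivrMl// pk /r.
have q0 : 0 <= dot (A k (w k)) (x k) - dot (A k (w k)) (p k).
  by rewrite -dotNr -dotDr -/(w k) -Nsqr sqr_ge0.
rewrite !dotE (dotC _ (x k) (A k (w k))) (dotC _ (x k) (B (x k))).
have gi0 : 0 <= (gamma k)^-1 by rewrite invr_ge0 ltW.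
have := mulr_ge0 gi0 q0; move: ((gamma k)^-1) => gi.
by lra.
Qed.

End Solution.

(** By polarization, [dot (x k) (A k (q - q'))] is a combination of the squared
    distances of [x k] to [q] and to [q'] and of the forms of [A k] at [q] and
    [q'], all convergent; its limits along [G] and [G'] therefore coincide. *)
Lemma weak_cluster_unique (G G' : set_system nat) q q' :
  UltraFilter G -> UltraFilter G' -> \oo `<=` G -> \oo `<=` G' ->
  (forall v, (fun k => dot (x k) v) @ G --> dot q v) ->
  (forall v, (fun k => dot (x k) v) @ G' --> dot q' v) ->
  VI_solutions dot C B q -> VI_solutions dot C B q' -> q = q'.
Proof.
move=> UG UG' ooG ooG' xq xq' Oq Oq'.
have [D xD] := iterates_norm_bounded Oq.
have A_cvg v : cvgn (fun k => A k v).
  apply: (@strong_limit _ _ _ hdot A eta alpha^-1) => //.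
  - by rewrite invr_ge0 ltW.
  - by move=> k u; rewrite -Nsqr sqr_ge0.
  - by move=> k u; exact: (inv_upper hdot alpha0 (PU k) (AK k)).
  - move=> k u; apply: (inv_antimono hdot alpha0 _ (PU k) (PU k.+1)) => //.
    by rewrite addr_ge0.
set v := q - q'; have Av := A_cvg v; set r := limn _ in Av.
pose s k := dot (x k) (A k v).
have dist2_cvg c : VI_solutions dot C B c -> cvgn (fun k => N k (x k - c) ^+ 2).
  by move=> /dist_cvg Nc; apply: cvgP; exact: cvg_sqr Nc.
have form_cvg c : cvgn (fun k => dot (A k c) c).
  by apply: cvgP; apply: (cvg_dot hdot); [exact: A_cvg|exact: cvg_cst].
have s_cvg : cvgn s.
  have -> : s = (fun=> 2^-1) \* ((fun k => N k (x k - q') ^+ 2) -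
      (fun k => N k (x k - q) ^+ 2) +
      ((fun k => dot (A k q) q) - (fun k => dot (A k q') q'))).
    apply/funext => k; rewrite /s /v /= !fctE !Nsqr !(opE (A k)) !dotE.
    rewrite (Asym k (x k) q) (Asym k (x k) q').
    by rewrite (dotC _ (A k q) (x k)) (dotC _ (A k q') (x k)); field.
  apply: is_cvgMl_tmp; apply: is_cvgD; apply: is_cvgB => //; exact: dist2_cvg.
have sG : s @ G --> dot q r by exact: cvg_dot_weak xD xq (cvg_finer ooG Av).
have sG' : s @ G' --> dot q' r by exact: cvg_dot_weak xD xq' (cvg_finer ooG' Av).
have qr : dot q r = limn s.
  by apply: (cvg_unique _ sG); [exact: Rhausdorff|exact: cvg_finer ooG s_cvg].
have qr' : dot q' r = limn s.
  by apply: (cvg_unique _ sG'); [exact: Rhausdorff|exact: cvg_finer ooG' s_cvg].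
have vr : dot r v = 0 by rewrite dotC /v dotDl dotNl qr qr' subrr.
apply: eq_of_dist_sqr_le0; rewrite -/v.
have muAv : (fun k => mu * dot (A k v) v) @ \oo --> mu * dot r v.
  by apply: cvgMl_tmp; apply: (cvg_dot hdot) => //; exact: cvg_cst.
have vv : (fun _ : nat => `|v| ^+ 2) @ \oo --> `|v| ^+ 2 by exact: cvg_cst.
have := ler_cvg_to vv muAv; rewrite vr mulr0; apply.
apply: nearW => k; apply: le_trans (mA k v) _.
by apply: ler_wpM2r; [rewrite -Nsqr sqr_ge0|exact: m_mu].
Qed.

Lemma weakly_cvg_solution : VI_solutions dot C B !=set0 ->
  exists2 xs, VI_solutions dot C B xs & weakly_cvg dot x xs.
Proof.
move=> [xs Oxs]; have [D xD] := iterates_norm_bounded Oxs.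
have cluster G : UltraFilter G -> \oo `<=` G -> exists2 q,
    VI_solutions dot C B q & forall v, (fun k => dot (x k) v) @ G --> dot q v.
  move=> UG ooG; have [q xq] := weak_ultra_limit hdot UG xD.
  by exists q => //; exact: (weak_cluster_solution Oxs UG ooG xq).
have [G [UG ooG]] := ultraFilterLemma eventually_filter.
have [q Oq xq] := cluster G UG ooG; exists q => //.
apply: weakly_cvg_ultra => G' UG' ooG'.
have [q' Oq' xq'] := cluster G' UG' ooG'.
by rewrite (weak_cluster_unique UG UG' ooG ooG' xq xq' Oq Oq').
Qed.

End Iteration.

(** * The convergence theorem *)

Theorem theorem4p1 (R : realType) (H : completeNormedModType R)
    (dot : {dot H for idfun}) (hdot : norm_from_dot dot)
    (C : set H) (C0 : C !=set0) (Cclosed : closed C) (Cconvex : convex_set C)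
    (B : H -> H) (beta : R) (beta_gt0 : 0 < beta)
    (Bcoco : cocoercive dot beta B)
    (Omega0 : VI_solutions dot C B !=set0)
    (alpha : R) (alpha_gt0 : 0 < alpha)
    (eta : nat -> R) (eta_ge0 : forall k, 0 <= eta k)
    (eta_sum : cvgn (series eta))
    (U : nat -> {linear H -> H}) (hU : forall k, Pcal dot alpha (U k))
    (mu : R) (U_bounded : has_ubound [set opnorm (U k) | k in [set: nat]])
    (mu_def : mu = sup [set opnorm (U k) | k in [set: nat]])
    (hUeta : forall k, loewner_ge dot ((1 + eta k) \*: U k.+1) (U k))
    (gamma lambda av : nat -> R)
    (gamma_bounds : forall k, 0 < gamma k < 2 * beta / opnorm (U k))
    (av_def : forall k,
       av k = 2 * beta / (4 * beta - gamma k * opnorm (U k)))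
    (lambda_bounds : forall k, 0 < lambda k < 1 / av k)
    (a b : nat -> H)
    (a_sum : cvgn (series (fun k => lambda k * `|a k|)))
    (b_sum : cvgn (series (fun k => lambda k * `|b k|)))
    (AorB :
      (exists lambda_ tau gamma_ epsilon : R,
        [/\ 0 < lambda_,
            forall k, lambda_ <= lambda k <= 1 / av k - tau,
            forall k, 0 < tau < 1 / av k - lambda_,
            0 < gamma_ /\
            (forall k, gamma_ <= gamma k <= (2 * beta - epsilon) / mu)
          & 0 < epsilon < 2 * beta - mu * gamma_])
      \/
      [/\ series (fun k => lambda k * (1 / av k - lambda k)) @ \oo --> +oo,
          exists gamma_ epsilon : R,
            [/\ 0 < gamma_,
                forall k, gamma_ <= gamma k <= (2 * beta - epsilon) / mu
              & 0 < epsilon < 2 * beta - mu * gamma_],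
          cvgn (series (fun k => `|gamma k.+1 - gamma k|)) /\
          cvgn (series (fun k =>
            `|gamma k.+1 * opnorm (U k.+1) - gamma k * opnorm (U k)|)),
          forall x : H,
            cvgn (series (fun k => `|opinv (U k) x - opinv (U k.+1) x|))
        & exists2 lambda_ : R, 0 < lambda_ & forall k, lambda_ <= lambda k])
    (x y : nat -> H)
    (y_def : forall k, y k = x k - gamma k *: U k (B (x k) + b k))
    (x_rec : forall k,
       x k.+1 = x k + lambda k *: (wproj dot (U k) C (y k) + a k - x k)) :
  [/\ forall xs, VI_solutions dot C B xs ->
        cvgn (fun k => wnorm dot (U k) (x k - xs)),
      (fun k =>
         `|x k - wproj dot (U k) C (x k - gamma k *: U k (B (x k)))|)
        @ \oo --> (0 : R),
      exists2 xs, VI_solutions dot C B xs & weakly_cvg dot x xs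
    & forall xs, VI_solutions dot C B xs -> B (x k) @[k --> \oo] --> B xs].
Proof.
have U0 k : 0 < opnorm (U k).
  have /andP[g0 g1] := gamma_bounds k; have := lt_trans g0 g1.
  by rewrite pmulr_rgt0 ?mulr_gt0// invr_gt0.
have U_mu k : opnorm (U k) <= mu by rewrite mu_def; apply: ub_le_sup => //; exists k.
have mu0 : 0 < mu := lt_le_trans (U0 0) (U_mu 0).
have [lambda_ [gamma_ [eps [[lambda0 gamma0 eps0] [lambda_ge gamma_ge gamma_mu]]]]] :
    exists lambda_ gamma_ eps : R, [/\ 0 < lambda_, 0 < gamma_ & 0 < eps] /\
      [/\ forall k, lambda_ <= lambda k, forall k, gamma_ <= gamma k &
          forall k, gamma k <= (2 * beta - eps) / mu].
  case: AorB => [[l [t [g [e [l0 lP _ [g0 gP] /andP[e0 _]]]]]]|].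
    exists l, g, e; split; split=> // k; first by have /andP[] := lP k.
      by have /andP[] := gP k.
    by have /andP[] := gP k.
  case=> _ [g [e [g0 gP /andP[e0 _]]]] _ _ [l l0 lP].
  by exists l, g, e; split; split=> // k; have /andP[] := gP k.
have gamma_le k : gamma k * opnorm (U k) <= 2 * beta - eps.
  have gk0 : 0 < gamma k := lt_le_trans gamma0 (gamma_ge k).
  apply: (@le_trans _ _ (gamma k * mu)); first by rewrite ler_pM2l.
  by rewrite -ler_pdivlMr.
have lambda_le k : lambda k <= 2 - gamma k * opnorm (U k) / (2 * beta).
  have /andP[_ /ltW] := lambda_bounds k; rewrite av_def.
  congr (_ <= _); field; rewrite !gt_eqF//.
  by have := gamma_le k; lra.
have /choice[A AP] k := opinvP hdot alpha_gt0 (hU k).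
have UA k : opinv (U k) = A k :> (H -> H) by case: (AP k).
have AK k : cancel (A k) (U k) by case: (AP k).
have KA k : cancel (U k) (A k) by case: (AP k).
have Asym k : self_adjoint dot (A k) by case: (AP k).
have [xs0 O0] := Omega0.
split.
- move=> xs Oxs.
  by apply: (@dist_cvg _ _ dot hdot C B alpha beta lambda_ gamma_ eps U A eta
    gamma lambda a b x y).
- by apply: (@residual_cvg0 _ _ dot hdot C B alpha beta lambda_ gamma_ eps mu U A eta
    gamma lambda a b x y) O0.
- by apply: (@weakly_cvg_solution _ _ dot hdot C B alpha beta lambda_ gamma_ eps mu U A eta
    gamma lambda a b x y).
- move=> xs Oxs.
  by apply: (@B_cvg _ _ dot hdot C B alpha beta lambda_ gamma_ eps mu U A eta
    gamma lambda a b x y) Oxs.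
Qed.
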